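(* Let $a,b\in\mathbb{Z}$ and $\mathbf{u}=(u_n)_{n\in\mathbb{N}}\in\{0,1\}^{\mathbb{N}}$. Let $f(0)=f(1)=1$, $f(2)=a+b$ and $f(n)=af(n-u_n-1)+bf(n-u_n-2)$ for $n\ge 3$. Assume that the following conditions hold: (1) for each $d\in\mathbb{N}$ there exists an integer $n_d\ge 2$ such that $u_{n_d+j}=0$ for each $j\in\{0,\ldots,d\}$; (2) $a\neq 0$, $b\notin\left\{-a^2,-\frac{a^2}{2},-\frac{a^2}{3}\right\}$ and $a^2+4b$ is not a square of an integer; (3) $f(n_d-1)f(n_d-2)\ne 0$ for infinitely many $d$. Then the set $\mathcal{V}(f)$ is infinite.
   Context: $\mathbb{N}=\{0,1,2,\ldots\}$. $\mathcal{V}(f)=\{f(n+1)/f(n): n\in\mathbb{N}\}$ denotes the set of quotients of consecutive terms of $f$, where only quotients that are defined (i.e. $f(n)\neq 0$) are considered. *)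

(* Defs.v *)
From mathcomp Require Import all_boot all_order all_algebra.
From mathcomp Require Import boolp classical_sets cardinality.

Set Implicit Arguments.
Unset Strict Implicit.
Unset Printing Implicit Defensive.

Import GRing.Theory Num.Theory.
Local Open Scope classical_set_scope.
Local Open Scope ring_scope.

Definition consecutive_quotients (f : nat -> int) : set rat :=
  [set (f n.+1)%:Q / (f n)%:Q | n in [set n : nat | f n != 0]].

(* Main.v *)
Require Import Defs.
From mathcomp Require Import all_boot all_order all_algebra.
From mathcomp Require Import boolp classical_sets cardinality.
From mathcomp Require Import algC algnum archimedean ring zify.

(** Where u vanishes, f obeys the binary recurrence
    x_(n+2) = a x_(n+1) + b x_n, so that the consecutive quotients form an orbit
    of the Moebius map r |-> a + b / r on the projective line over the
    rationals (a zero of f being the point at infinity).  If V(f) were finite,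
    the orbit along a stretch longer than the number of available points would
    meet the same point twice [slope_collision].

    A long stretch cannot do that [linear_stretch_slopes_distinct].  Let l1, l2
    be the roots of X^2 - a X - b.  The eigencoordinates x_(n+1) - l2 x_n and
    x_(n+1) - l1 x_n are geometric, of ratios l1 and l2, and neither vanishes,
    because a^2 + 4 b is not a square and the matrix of the recurrence has no
    rational eigenvector [no_integer_eigenline].  The projective point is
    determined by the ratio of these coordinates, which is multiplied by l1 / l2
    at each step; a repetition after k steps thus forces (l1 / l2)^k = 1.

    But then t = l1 / l2 + l2 / l1 = -(a^2 + 2 b) / b is rational, an algebraic
    integer, and of absolute value at most 2, so t is one of -2, -1, 0, 1, 2
    [rational_trace_unity_root].  These values mean respectively a = 0,
    a^2 + b = 0, a^2 + 2 b = 0, a^2 + 3 b = 0 and a^2 + 4 b = 0, which the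
    hypotheses exclude [root_ratio_not_unity]. *)

Set Implicit Arguments.
Unset Strict Implicit.
Unset Printing Implicit Defensive.

Import Order.TTheory GRing.Theory Num.Theory.
Local Open Scope classical_set_scope.
Local Open Scope ring_scope.

(** This is how the roots of unity of degree at most two over the rationals,
    those of order 1, 2, 3, 4 and 6, enter the proof: the sum of a root of unity
    and its inverse is an algebraic integer, hence an integer when rational,
    and the triangle inequality bounds it. *)
Lemma rational_trace_unity_root (k : nat) (z : algC) :
    (0 < k)%N -> z ^+ k = 1 -> z + z^-1 \in Crat ->
  exists2 t : int, z + z^-1 = t%:~R & (`|t| <= 2)%R.
Proof.
move=> k_gt0 zk1 trQ.
have zVk1 : z^-1 ^+ k = 1 by rewrite exprVn zk1 invr1.
have AintU w : w ^+ k = 1 -> w \in Aint.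
  by move=> wk1; apply: (Aint_unity_root k_gt0); apply/unity_rootP.
have normU w : w ^+ k = 1 -> `|w| = 1.
  move=> wk1; apply/eqP; rewrite -(@pexpr_eq1 _ _ k) //.
  by rewrite -normrX wk1 normr1.
have /intrP[t tE] : z + z^-1 \in Num.int.
  by apply: Cint_rat_Aint => //; apply: rpredD; apply: AintU.
exists t => //; rewrite -(ler_int algC) intr_norm -tE.
by apply: le_trans (ler_normD _ _) _; rewrite !normU.
Qed.

(** The trace t of l1 / l2 satisfies - b t = a^2 + 2 b, and each of the five
    integers t allowed for a root of unity turns this into the vanishing of one
    of the excluded expressions. *)
Lemma root_ratio_not_unity (a b : int) (l1 l2 : algC) (k : nat) :
    a != 0 -> a ^+ 2 + b != 0 -> a ^+ 2 + 2 * b != 0 -> a ^+ 2 + 3 * b != 0 ->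
    a ^+ 2 + 4 * b != 0 -> b != 0 ->
    l1 + l2 = a%:~R -> l1 * l2 = - b%:~R -> (0 < k)%N ->
  (l1 / l2) ^+ k != 1.
Proof.
move=> a0 h1 h2 h3 h4 b0 sum_l prod_l k_gt0; apply/eqP => zk1.
have bC0 : b%:~R != 0 :> algC by rewrite intr_eq0.
have : l1 * l2 != 0 by rewrite prod_l oppr_eq0.
rewrite mulf_eq0 negb_or => /andP[l1_0 l2_0].
have trE : - b%:~R * (l1 / l2 + (l1 / l2)^-1) = a%:~R ^+ 2 + 2 * b%:~R.
  rewrite -sum_l -[b%:~R in RHS]opprK -prod_l.
  by field; rewrite l1_0 l2_0.
have trQ : l1 / l2 + (l1 / l2)^-1 \in Crat.
  have -> : l1 / l2 + (l1 / l2)^-1 =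
            (a%:~R ^+ 2 + 2 * b%:~R) / (- b%:~R).
    by rewrite -trE mulrAC divff ?mul1r // oppr_eq0.
  by rewrite rpred_div ?rpredD ?rpredN ?rpredM ?rpredX ?rpred_int ?rpred_nat.
have [t tE t_le2] := rational_trace_unity_root k_gt0 zk1 trQ.
have {}trE : - b * t = a ^+ 2 + 2 * b.
  apply: (@intr_inj algC); rewrite rmorphM rmorphN /= -tE trE.
  by rewrite rmorphD rmorphXn rmorphM.
have : t \in [:: -2; -1; 0; 1; 2] by rewrite !inE; lia.
rewrite !inE => /or4P[||| /orP[]] /eqP tv; move: trE; rewrite tv => trE.
- have /eqP : a ^+ 2 = 0 by lia.
  by rewrite sqrf_eq0 (negPf a0).
- by move/eqP: h1; lia.
- by move/eqP: h2; lia.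
- by move/eqP: h3; lia.
- by move/eqP: h4; lia.
Qed.

(** The equation says that (x, y) lies on an eigenline y = l x of the recurrence
    matrix; completing the square gives (2 y - a x)^2 = (a^2 + 4 b) x^2, so x
    divides 2 y - a x and a nonzero x would make a^2 + 4 b a square. *)
Lemma no_integer_eigenline (a b x y : int) :
    ~ (exists c : int, a ^+ 2 + 4%:R * b = c ^+ 2) ->
  y ^+ 2 = a * (x * y) + b * x ^+ 2 -> x = 0.
Proof.
move=> nsq eq_xy; apply/eqP; apply: contra_notT nsq => x0.
have sqE : (2 * y - a * x) ^+ 2 = (a ^+ 2 + 4 * b) * x ^+ 2 
    by rewrite -[LHS]addr0 -(addNr (4 * y ^+ 2)) {2}eq_xy; ring.
have /dvdzP[c cE] : (x %| 2 * y - a * x)%Z.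
  by rewrite -(@dvdz_pexp2r _ _ 2) // sqE dvdz_mull.
exists c; apply: (@mulIf _ (x ^+ 2)); first by rewrite expf_neq0.
by rewrite -sqE cE exprMn.
Qed.

(** Slopes are compared by cross-multiplication, so that zero terms of g, which
    stand for the point at infinity, need no separate treatment. *)
Lemma linear_stretch_slopes_distinct (a b : int) (g : nat -> int) (K i j : nat) :
    a != 0 -> a ^+ 2 + b != 0 -> a ^+ 2 + 2 * b != 0 -> a ^+ 2 + 3 * b != 0 ->
    ~ (exists c : int, a ^+ 2 + 4%:R * b = c ^+ 2) ->
    (forall n, (n < K)%N -> g n.+2 = a * g n.+1 + b * g n) ->
    g 0%N != 0 -> (i < j <= K)%N ->
  g i.+1 * g j != g j.+1 * g i.
Proof.
move=> a0 h1 h2 h3 nsq g_rec g0 /andP[ij jK]; apply/eqP => propE.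
have h4 : a ^+ 2 + 4 * b != 0.
  by apply/eqP => h; apply: nsq; exists 0; rewrite h expr0n.
have b0 : b != 0.
  by apply/eqP => h; apply: nsq; exists a; rewrite h mulr0 addr0.
pose s : algC := sqrtC (a ^+ 2 + 4 * b)%:~R.
pose l1 : algC := (a%:~R + s) / 2; pose l2 : algC := (a%:~R - s) / 2.
have sE : s ^+ 2 = a%:~R ^+ 2 + 4 * b%:~R.
  by rewrite sqrtCK rmorphD rmorphXn rmorphM.
have sum_l : l1 + l2 = a%:~R by rewrite /l1 /l2; field.
have prod_l : l1 * l2 = - b%:~R.
  have -> : l1 * l2 = (a%:~R ^+ 2 - s ^+ 2) / 4 by rewrite /l1 /l2; field.
  by rewrite sE; field.
(* For {p, q} = {l1, l2}, E q is the eigencoordinate of eigenvalue p. *)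
pose E (l : algC) n : algC := (g n.+1)%:~R - l * (g n)%:~R.
have E_pow p q : p + q = a%:~R -> p * q = - b%:~R ->
    forall n, (n <= K)%N -> E q n = p ^+ n * E q 0%N.
  move=> sum_pq prod_pq; elim=> [|n IHn] nK; first by rewrite mul1r.
  rewrite exprS -mulrA -IHn 1?ltnW // /E g_rec // rmorphD !rmorphM /=.
  by rewrite -sum_pq -[b%:~R]opprK -prod_pq; ring.
have E0_neq0 p q : p + q = a%:~R -> p * q = - b%:~R -> E q 0%N != 0.
  move=> sum_pq prod_pq; apply: contra_neq g0 => /eqP; rewrite subr_eq0 => /eqP gE.
  apply: (no_integer_eigenline (y := g 1%N) nsq); apply: (@intr_inj algC).
  rewrite rmorphD rmorphXn !rmorphM /= gE.
  by rewrite -sum_pq -[b%:~R]opprK -prod_pq; ring.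
have sum_l' : l2 + l1 = a%:~R by rewrite addrC.
have prod_l' : l2 * l1 = - b%:~R by rewrite mulrC.
(* E l2 j * E l1 i - E l2 i * E l1 j is (l2 - l1) times the determinant of
   the vectors (g i, g i.+1) and (g j, g j.+1). *)
have cross : E l2 j * E l1 i = E l2 i * E l1 j.
  move/(congr1 (fun m : int => m%:~R : algC)): propE; rewrite !rmorphM /= => propE.
  by apply/eqP; rewrite -subr_eq0 /E; apply/eqP; ring: propE.
have : l1 * l2 != 0 by rewrite prod_l oppr_eq0 intr_eq0.
rewrite mulf_eq0 negb_or => /andP[l1_0 l2_0].
have iK : (i <= K)%N by apply: leq_trans jK; apply: ltnW.
have powE : l1 ^+ j * l2 ^+ i = l1 ^+ i * l2 ^+ j.
  have EE0 : E l2 0%N * E l1 0%N != 0.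
    by apply: mulf_neq0; [apply: (E0_neq0 l1)|apply: (E0_neq0 l2)].
  apply: (mulIf EE0); move: cross.
  rewrite (E_pow _ _ sum_l prod_l _ jK) (E_pow _ _ sum_l prod_l _ iK).
  rewrite (E_pow _ _ sum_l' prod_l' _ jK) (E_pow _ _ sum_l' prod_l' _ iK).
  by rewrite !(mulrACA _ (E _ _)).
have k_gt0 : (0 < j - i)%N by rewrite subn_gt0.
have /eqP[] := root_ratio_not_unity a0 h1 h2 h3 h4 b0 sum_l prod_l k_gt0.
apply: (@mulIf _ (l1 ^+ i * l2 ^+ j)); first by rewrite mulf_neq0 ?expf_neq0.
rewrite mul1r -[RHS]powE expr_div_n -{3 4}(subnK (ltnW ij)) !exprD.
by field; rewrite expf_neq0.
Qed.

(** Pigeonhole on the projective line: the points (f n : f (n+1)) with f n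
    nonzero are finitely many, and the point at infinity, encoded as None, stands
    for all the others.  The bound N does not depend on where the window starts,
    which lets the window be placed inside a stretch of zeros of u. *)
Lemma slope_collision (f : nat -> int) : finite_set (consecutive_quotients f) ->
  exists N : nat, forall m : nat, exists i j : nat,
    (i < j <= N)%N /\ f (m + i).+1 * f (m + j)%N = f (m + j).+1 * f (m + i)%N.
Proof.
move=> /finite_seqP[s sE].
pose slope n : option rat :=
  if f n == 0 then None else Some ((f n.+1)%:Q / (f n)%:Q).
have slope_in n : slope n \in None :: map Some s.
  rewrite /slope; have [//|fn0] := eqVneq (f n) 0.
  rewrite in_cons /=; apply: map_f.
  suff : consecutive_quotients f ((f n.+1)%:Q / (f n)%:Q) by rewrite sE.
  by exists n.
have slope_eq n p : slope n = slope p -> f n.+1 * f p = f p.+1 * f n.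
  rewrite /slope; case: eqP => [->|/eqP fn0]; case: eqP => [->|/eqP fp0] //.
    by rewrite !mulr0.
  case=> /eqP; rewrite eqr_div ?intr_eq0 // -!rmorphM /= => /eqP.
  exact: intr_inj.
exists (size s).+1 => m.
pose t := [seq slope (m + i)%N | i <- iota 0 (size s).+2].
have sub_t : {subset t <= None :: map Some s} by move=> _ /mapP[i _ ->].
have : ~~ uniq t.
  apply/negP => /uniq_leq_size/(_ sub_t).
  by rewrite /t !size_map /= size_map size_iota ltnn.
have sz_t : size t = (size s).+2 by rewrite size_map size_iota.
case/(uniqPn None) => i [j [ij]]; rewrite sz_t => jN.
rewrite !(nth_map 0%N) ?size_iota ?(ltn_trans ij) // !nth_iota ?(ltn_trans ij) //.
by move=> /slope_eq eq_ij; exists i, j; rewrite ij.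
Qed.

Theorem theorem6p4 (a b : int) (u : nat -> nat) (f : nat -> int)
    (nd : nat -> nat)
    (u01 : forall n : nat, u n \in [:: 0%N; 1%N])
    (f0 : f 0%N = 1) (f1 : f 1%N = 1) (f2 : f 2%N = a + b)
    (f_rec : forall n : nat, (3 <= n)%N ->
       f n = a * f (n - u n - 1)%N + b * f (n - u n - 2)%N)
    (nd_ge2 : forall d : nat, (2 <= nd d)%N)
    (u_nd : forall d j : nat, (j <= d)%N -> u (nd d + j)%N = 0%N)
    (a_neq0 : a != 0)
    (b_notin : b%:Q \notin
       [:: - a%:Q ^+ 2; - (a%:Q ^+ 2 / 2%:R); - (a%:Q ^+ 2 / 3%:R)])
    (disc_nonsquare : ~ exists c : int, a ^+ 2 + 4%:R * b = c ^+ 2)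
    (f_nd : infinite_set
       [set d : nat | f (nd d - 1)%N * f (nd d - 2)%N != 0]) :
  infinite_set (consecutive_quotients f).
Proof.
have b_neq (k : int) : k != 0 -> b%:Q != - (a%:Q ^+ 2 / k%:Q) ->
    a ^+ 2 + k * b != 0.
  move=> k0; apply: contra_neq => abk.
  have {abk} -> : a%:Q ^+ 2 = - (k%:Q * b%:Q).
    by apply/eqP; rewrite -addr_eq0 -rmorphXn -rmorphM -rmorphD abk.
  by field; rewrite intr_eq0.
move: b_notin; rewrite !inE !negb_or => /and3P[b1 b2 b3].
have h1 : a ^+ 2 + b != 0 by rewrite -[b]mul1r b_neq // divr1.
have h2 : a ^+ 2 + 2 * b != 0 by rewrite b_neq.
have h3 : a ^+ 2 + 3 * b != 0 by rewrite b_neq.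
move=> /slope_collision[N coll].
(* Infinitely many d have nonzero initial terms, so one of them is at least N. *)
have [d /= fd Nd] : exists2 d, f (nd d - 1)%N * f (nd d - 2)%N != 0 & (N <= d)%N.
  apply: contrapT => noN; apply: f_nd; apply: (sub_finite_set _ (finite_II N)).
  by move=> d /= fd; rewrite ltnNge; apply/negP => Nd; apply: noN; exists d.
have [i [j [ijN eq_ij]]] := coll (nd d - 2)%N.
have fd0 : f (nd d - 2 + 0)%N != 0.
  by rewrite addn0; apply: contraNneq fd => ->; rewrite mulr0.
have := linear_stretch_slopes_distinct (g := fun n => f (nd d - 2 + n)%N)
  (K := N) a_neq0 h1 h2 h3 disc_nonsquare _ fd0 ijN.
rewrite !addnS eq_ij eqxx => /(_ _)/notF; apply=> n nN; rewrite !addnS.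
have nd2 := nd_ge2 d.
have u0 : u (nd d - 2 + n).+2 = 0%N.
  have -> : (nd d - 2 + n).+2 = (nd d + n)%N by lia.
  by rewrite u_nd // (leq_trans (ltnW nN)).
(* The recurrence starts at index 3; the value f 2 = a + b fits it with u = 0. *)
have [->|m_gt0] := posnP (nd d - 2 + n)%N; first by rewrite f0 f1 f2 !mulr1.
by rewrite f_rec ?u0 ?subn0 ?subn1 ?subn2 //; lia.
Qed.
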